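(* For every pair of positive integers $n<m$, there exists an orbit equivalence coupling between $\mathbb Z^m$ and $\mathbb Z^n$ that is $(\mathrm L^p,\mathrm L^p)$-integrable for every $p<n/m$.
   Context: An orbit equivalence coupling between finitely generated groups $\Gamma=\langle S_\Gamma\rangle$ and $\Lambda=\langle S_\Lambda\rangle$ ($S_\Gamma,S_\Lambda$ finite symmetric) is a standard probability space $(X,\mu)$ with free (up to null sets) measure-preserving actions of $\Gamma$ and $\Lambda$ such that $\Gamma\cdot x=\Lambda\cdot x$ for almost every $x\in X$. For $y\in\Lambda\cdot x$, $d_{S_\Lambda}(x,y)$ is the minimal word length of $\lambda\in\Lambda$ with $y=\lambda\cdot x$; $d_{S_\Gamma}$ is defined similarly. For $p>0$, the coupling is $(\mathrm L^p,\mathrm L^p)$-integrable if $\int_Xd_{S_\Lambda}(x,\gamma\cdot x)^p\,d\mu(x)<\infty$ for all $\gamma\in\Gamma$ and $\int_Xd_{S_\Gamma}(x,\lambda\cdot x)^p\,d\mu(x)<\infty$ for all $\lambda\in\Lambda$. *)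

(* Defs.v *)
From HB Require Import structures.
From mathcomp Require Import all_boot all_order all_algebra.
From mathcomp Require Import all_classical all_reals all_analysis.

Set Implicit Arguments.
Unset Strict Implicit.
Unset Printing Implicit Defensive.

Import Order.TTheory GRing.Theory Num.Theory.
Import numFieldNormedType.Exports.

Local Open Scope classical_set_scope.
Local Open Scope ring_scope.
Local Open Scope ereal_scope.

(* A Hausdorff pseudometric is a metric, so Y below ranges over Polish spaces. *)
Definition standard_borel (R : realType) (d : measure_display)
    (X : measurableType d) : Prop :=
  exists (Y : completePseudoMetricType R) (f : X -> Y),
    [/\ hausdorff_space Y,
        exists2 D : set Y, countable D & dense D,
        bijective f
      & forall A : set X, measurable A <-> <<s [set U : set Y | open U] >> (f @` A)].

(* Groups are written additively, hence abelian: only Z^m and Z^n are needed. *)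
Section Actions.
Variables (R : realType) (d : measure_display) (X : measurableType d).
Variables (mu : probability X R) (G : zmodType) (act : G -> X -> X).

Definition is_action : Prop :=
  (forall x, act 0%R x = x) /\ (forall g h x, act (g + h)%R x = act g (act h x)).

Definition pmp : Prop :=
  forall g, measurable_fun [set: X] (act g) /\
    forall A, measurable A -> mu (act g @^-1` A) = mu A.

Definition ess_free : Prop :=
  {ae mu, forall x, forall g, act g x = x -> g = 0%R}.

Definition orbit_of (x : X) : set X := [set act g x | g in [set: G]].

End Actions.

Definition oe_coupling (R : realType) (d : measure_display)
    (X : measurableType d) (mu : probability X R) (G L : zmodType)
    (actG : G -> X -> X) (actL : L -> X -> X) : Prop :=
  [/\ standard_borel R X,
      [/\ is_action actG, pmp mu actG & ess_free mu actG],
      [/\ is_action actL, pmp mu actL & ess_free mu actL]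
    & {ae mu, forall x, orbit_of actG x = orbit_of actL x}].

Definition word_repr (G : zmodType) (S : seq G) (g : G) (w : seq G) : Prop :=
  {subset w <= S} /\ g = (\sum_(s <- w) s)%R.

Definition sym_generating (G : zmodType) (S : seq G) : Prop :=
  (forall s, s \in S -> (- s)%R \in S) /\ (forall g, exists w, word_repr S g w).

Definition word_length (R : realType) (G : zmodType) (S : seq G) (g : G) : \bar R :=
  ereal_inf [set (size w)%:R%:E | w in word_repr S g].

(* Equal to +oo when y is not in the orbit of x. *)
Definition orbit_dist (R : realType) (X : Type) (G : zmodType) (S : seq G)
    (act : G -> X -> X) (x y : X) : \bar R :=
  ereal_inf [set word_length R S g | g in [set g | y = act g x]].

Definition LpLp_integrable (R : realType) (d : measure_display)
    (X : measurableType d) (mu : probability X R) (G L : zmodType)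
    (SG : seq G) (SL : seq L) (actG : G -> X -> X) (actL : L -> X -> X)
    (p : R) : Prop :=
  (forall g, \int[mu]_x (orbit_dist R SL actL x (actG g x) `^ p) < +oo) /\
  (forall l, \int[mu]_x (orbit_dist R SG actG x (actL l x) `^ p) < +oo).

(* Main.v *)
Require Import Defs.
From HB Require Import structures.
From mathcomp Require Import all_boot all_order all_algebra.
From mathcomp Require Import zify ring lra.
From mathcomp Require Import all_classical all_reals all_analysis.
From mathcomp Require Import measurable_realfun.

(** Both groups act on the Cantor space of bit sequences with the fair coin
    measure. Interleaving a 2-adic integers identifies this space with Z_2^a, on
    which Z^a acts by translation. Whatever a is, almost every orbit is the class
    of the sequences with the same tail, so the actions of Z^m and Z^n are orbit
    equivalent. A translation of Z_2^a changes digits beyond the k a b lowest ones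
    with probability O(2^(-k b)), while two sequences that differ only in these
    digits are translates of each other by a vector of Z^b with entries below
    2^(k a). Hence the p-th moment of the Z^b-distance is at most a multiple of
    the geometric series with ratio 2^(p a - b), which converges for p < b / a.
    Both (a, b) = (m, n) and (a, b) = (n, m) are covered when p < n / m. *)

Set Implicit Arguments.
Unset Strict Implicit.
Unset Printing Implicit Defensive.

Import Order.TTheory GRing.Theory Num.Theory.
Import numFieldNormedType.Exports.
Local Open Scope classical_set_scope.
Local Open Scope ring_scope.

(** * Translations of the 2-adic integers *)

(** The bits of [x] are the digits of a 2-adic integer, lowest first; this is its residue modulo
    [2 ^ r]. *)
Definition low_bits (x : nat -> bool) (r : nat) : int :=
  \sum_(j < r) (x j)%:Z * 2 ^+ j.

Lemma low_bits0 x : low_bits x 0 = 0. Proof. exact: big_ord0. Qed.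

Lemma low_bitsS x r : low_bits x r.+1 = low_bits x r + (x r)%:Z * 2 ^+ r.
Proof. exact: big_ord_recr. Qed.

Lemma low_bits_bounds x r : 0 <= low_bits x r < 2 ^+ r.
Proof.
elim: r => [|r IH]; first by rewrite low_bits0.
rewrite low_bitsS exprS; move: IH (exprn_gt0 r (ltr0Sn int 1)).
by case: (x r); rewrite ?mul1r ?mul0r; lia.
Qed.

Lemma low_bits_inj x y : low_bits x =1 low_bits y -> x = y.
Proof.
move=> xy; apply/funext => r.
have := xy r.+1; rewrite !low_bitsS xy => /addrI /mulIf.
rewrite expf_neq0// => /(_ isT).
by case: (x r); case: (y r).
Qed.

Lemma eq_low_bits x y r : (forall j, (j < r)%N -> x j = y j) ->
  low_bits x r = low_bits y r.
Proof. by move=> xy; apply: eq_bigr => j _; rewrite xy. Qed.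

(* The 2-adic sum x + g: its digit r only depends on x modulo 2 ^ r.+1. *)
Definition adic_add (g : int) (x : nat -> bool) : nat -> bool :=
  fun r => (((low_bits x r.+1 + g) %/ 2 ^+ r)%Z %% 2)%Z == 1.

Lemma modz_exp2S (z : int) r :
  (z %% 2 ^+ r.+1)%Z = (z %% 2 ^+ r)%Z + ((z %/ 2 ^+ r)%Z %% 2)%Z * 2 ^+ r.
Proof.
have q0 : 0 < 2 ^+ r :> int by rewrite exprn_gt0.
have e1 := divz_eq z (2 ^+ r); have e2 := divz_eq (z %/ 2 ^+ r)%Z 2.
have b1 : 0 <= (z %% 2 ^+ r)%Z < 2 ^+ r by rewrite modz_ge0 ?gt_eqF//= ltz_pmod.
set q := 2 ^+ r in e1 e2 b1 q0 *; set d := (z %/ q)%Z in e1 e2 *.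
set m := (z %% q)%Z in e1 b1 *.
rewrite exprS -/q e1 {1}e2 mulrDl -mulrA -addrA modzMDl.
have : 0 <= (d %% 2)%Z < 2 by rewrite modz_ge0//= ltz_pmod.
by move=> hb; rewrite modz_small; [rewrite addrC|nia].
Qed.

(** This identifies [adic_add] with 2-adic addition. Together with [low_bits_inj] it reduces
    identities between translates to modular arithmetic. *)
Lemma low_bits_adic_add g x r :
  low_bits (adic_add g x) r = ((low_bits x r + g) %% 2 ^+ r)%Z.
Proof.
elim: r => [|r IH]; first by rewrite low_bits0 expr0 modz1.
rewrite low_bitsS IH modz_exp2S; congr (_ + _ * _).
  by rewrite low_bitsS addrAC [in RHS]addrC modzMDl.
rewrite /adic_add; set d := (_ %/ _)%Z.
have : 0 <= (d %% 2)%Z < 2 by rewrite modz_ge0//= ltz_pmod.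
by case: eqP; lia.
Qed.

Lemma adic_add0 x : adic_add 0 x = x.
Proof.
apply: low_bits_inj => r.
by rewrite low_bits_adic_add addr0 modz_small ?low_bits_bounds.
Qed.

Lemma adic_addD g h x : adic_add (g + h) x = adic_add g (adic_add h x).
Proof.
apply: low_bits_inj => r.
by rewrite !low_bits_adic_add modzDml -addrA (addrC g).
Qed.

Lemma eq_adic_add g x y r : (forall j, (j < r)%N -> x j = y j) ->
  forall j, (j < r)%N -> adic_add g x j = adic_add g y j.
Proof.
move=> xy j jr; rewrite /adic_add (@eq_low_bits x y)// => k kj.
exact/xy/(leq_trans kj).
Qed.

Lemma adic_add_free g x : adic_add g x = x -> g = 0.
Proof.
move=> gx; apply/eqP; apply: contraT => g0.
have dvd r : (2 ^+ r %| g)%Z.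
  have /eqP := low_bits_adic_add g x r.
  rewrite gx -{1}[low_bits x r](@modz_small _ (2 ^+ r)) ?low_bits_bounds//.
  by rewrite eqz_mod_dvd opprD addrA subrr sub0r rpredN.
(* With [r] equal to the absolute value of [g], the divisor [2 ^ r] is too large for a nonzero
   [g]. *)
have := dvd `|g|%N; rewrite dvdzE abszX gtnNdvd ?absz_gt0//; exact: ltn_expl.
Qed.

(** If the lowest [r] digits absorb [g], so does every longer prefix. At all levels [s >= r] the two
    residues then differ by exactly [g], and subtracting consecutive levels equates the digits. *)
Lemma adic_add_carry_free g x r : 0 <= low_bits x r + g < 2 ^+ r ->
  forall s, (r <= s)%N -> adic_add g x s = x s.
Proof.
move=> xg.
have key s : (r <= s)%N -> 0 <= low_bits x s + g < 2 ^+ s.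
  move=> /subnK <-; elim: (s - r)%N => [|k]; first by rewrite add0n.
  rewrite addSn low_bitsS exprS; move: (exprn_gt0 (k + r) (ltr0Sn int 1)).
  by case: (x _); rewrite ?mul1r ?mul0r; lia.
have val_eq s : (r <= s)%N -> low_bits (adic_add g x) s = low_bits x s + g.
  by move=> rs; rewrite low_bits_adic_add modz_small ?key.
move=> s rs; have := val_eq _ (leqW rs); rewrite !low_bitsS val_eq//.
rewrite addrAC => /addIr/addrI/mulIf; rewrite expf_neq0// => /(_ isT).
by case: (adic_add _ _ _); case: (x s).
Qed.

Lemma eq_tail_adic_add x y r : (forall j, (r <= j)%N -> x j = y j) ->
  exists2 g, y = adic_add g x & `|g| < 2 ^+ r.
Proof.
(* The equal tails cancel in [y - x], which is therefore the integer represented by the low digits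
   alone. *)
move=> xy; exists (low_bits y r - low_bits x r); last first.
  by have := low_bits_bounds x r; have := low_bits_bounds y r; lia.
apply: low_bits_inj => s; rewrite low_bits_adic_add.
(* Above level [r] the required identity holds between integers; up to level [r] it holds only
   modulo [2 ^ s]. *)
have [sr|rs] := leqP s r; last first.
  have -> : low_bits x s + (low_bits y r - low_bits x r) = low_bits y s.
    rewrite -(subnK (ltnW rs)).
    elim: (s - r)%N => [|k IH]; first by rewrite add0n; lia.
    by rewrite addSn !low_bitsS -IH xy ?leq_addl//; lia.
  by rewrite modz_small ?low_bits_bounds.
have low z : exists k, low_bits z r = low_bits z s + k * 2 ^+ s.
  rewrite -(subnK sr); elim: (r - s)%N => [|i [k IH]].
    by exists 0; rewrite mul0r addr0.
  exists (k + (z (i + s)%N)%:Z * 2 ^+ i).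
  by rewrite addSn low_bitsS IH exprD; ring.
have [[k ->] [l ->]] := (low x, low y).
rewrite (_ : _ + _ = (l - k) * 2 ^+ s + low_bits y s); last by ring.
by rewrite modzMDl modz_small ?low_bits_bounds.
Qed.

(** * The odometer of rank a *)

(* The i-th of the a 2-adic integers interleaved in x. *)
Definition strand (a i : nat) (x : nat -> bool) : nat -> bool :=
  fun r => x (r * a + i)%N.

(** Indexing by [nat], with value 0 out of range, allows the index [j %% a] without a bound
    proof. *)
Definition entry a (g : 'rV[int]_a) (k : nat) : int := oapp (g 0) 0 (insub k).

Definition odometer a (g : 'rV[int]_a) (x : nat -> bool) : nat -> bool :=
  fun j => adic_add (entry g (j %% a)) (strand a (j %% a) x) (j %/ a).

Lemma entryE a (g : 'rV[int]_a) (i : 'I_a) : entry g i = g 0 i.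
Proof. by rewrite /entry insubT//= => lti; congr (g 0 _); exact: val_inj. Qed.

Lemma entry0 a k : entry (0 : 'rV[int]_a) k = 0.
Proof. by rewrite /entry; case: insub => //= i; rewrite mxE. Qed.

Lemma entryD a (g h : 'rV[int]_a) k : entry (g + h) k = entry g k + entry h k.
Proof. by rewrite /entry; case: insub => [i|]/=; rewrite ?mxE ?addr0. Qed.

Section Odometer.
Variables (a : nat) (a_gt0 : (0 < a)%N).
Implicit Types (g h : 'rV[int]_a) (x y : nat -> bool).

Lemma strand_odometer g x i : (i < a)%N ->
  strand a i (odometer g x) = adic_add (entry g i) (strand a i x).
Proof.
move=> ia; apply/funext => r.
by rewrite /odometer {1}/strand divnMDl// modnMDl divn_small// addn0 modn_small.
Qed.

Lemma strand_inj x y :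
  (forall i, (i < a)%N -> strand a i x = strand a i y) -> x = y.
Proof.
move=> xy; apply/funext => j; rewrite (divn_eq j a).
exact: (congr1 (fun f => f (j %/ a)%N) (xy _ (ltn_pmod j a_gt0))).
Qed.

Lemma odometer0 x : odometer (0 : 'rV[int]_a) x = x.
Proof.
by apply: strand_inj => i ia; rewrite strand_odometer// entry0 adic_add0.
Qed.

Lemma odometerD g h x : odometer (g + h) x = odometer g (odometer h x).
Proof.
by apply: strand_inj => i ia; rewrite !strand_odometer// entryD adic_addD.
Qed.

Lemma odometer_free g x : odometer g x = x -> g = 0.
Proof.
move=> gx; apply/rowP => i; rewrite mxE -entryE.
by apply: (@adic_add_free _ (strand a i x)); rewrite -strand_odometer// gx.
Qed.

(** Carries only move upwards: digit [j] of the image depends on digits of its own strand at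
    positions up to [j]. *)
Lemma eq_odometer g x y N : (forall j, (j < N)%N -> x j = y j) ->
  forall j, (j < N)%N -> odometer g x j = odometer g y j.
Proof.
move=> xy j jN; apply: (@eq_adic_add _ _ _ (j %/ a).+1) => // k kj.
apply: xy; apply: leq_ltn_trans jN.
by rewrite {2}(divn_eq j a) leq_add2r leq_mul2r -ltnS kj orbT.
Qed.

(** The first [r * a] positions hold exactly the lowest [r] digits of all strands, so the statement
    reduces to one strand. *)
Lemma odometer_carry_free g x r :
  (forall i : 'I_a, 0 <= low_bits (strand a i x) r + g 0 i < 2 ^+ r) ->
  forall j, (r * a <= j)%N -> odometer g x j = x j.
Proof.
move=> xg j rj; have ja := ltn_pmod j a_gt0.
rewrite /odometer (@adic_add_carry_free _ _ r).
- by rewrite /strand -divn_eq.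
- by have := xg (Ordinal ja); rewrite -entryE.
- by rewrite leq_divRL.
Qed.

Lemma eq_tail_odometer x y r : (forall j, (r * a <= j)%N -> x j = y j) ->
  exists2 g : 'rV[int]_a, y = odometer g x & forall i, `|g 0 i| < 2 ^+ r.
Proof.
move=> xy.
have cP (i : 'I_a) : exists z : int,
    strand a i y = adic_add z (strand a i x) /\ `|z| < 2 ^+ r.
  have [j rj|z yz zr] := @eq_tail_adic_add (strand a i x) (strand a i y) r.
    by apply: xy; rewrite (leq_trans _ (leq_addr _ _))// leq_mul2r rj orbT.
  by exists z.
have [c {}cP] := choice cP.
exists (\row_i c i) => [|i]; last by rewrite mxE; have [] := cP i.
apply: strand_inj => i ia; rewrite strand_odometer//.
have [-> _] := cP (Ordinal ia).
by rewrite -[in RHS]/(nat_of_ord (Ordinal ia)) entryE mxE.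
Qed.

End Odometer.

(** * Word lengths in Z^a *)

Lemma word_repr_cat (G : zmodType) (S : seq G) g h w v :
  word_repr S g w -> word_repr S h v -> word_repr S (g + h) (w ++ v).
Proof.
move=> [wS ->] [vS ->]; split; last by rewrite big_cat.
by move=> s; rewrite mem_cat => /orP[/wS|/vS].
Qed.

Lemma word_repr_opp (G : zmodType) (S : seq G) g w :
  (forall s, s \in S -> - s \in S) ->
  word_repr S g w -> word_repr S (- g) (map -%R w).
Proof.
move=> Sopp [wS ->]; split; last by rewrite big_map raddf_sum.
by move=> _ /mapP[s /wS sS ->]; exact: Sopp.
Qed.

(** Fix a word for each basis vector and let [K] be their total length. Then [g] is spelled by
    repeating each of these words, or its opposite, as often as the absolute value of the entry
    demands. *)
Lemma word_repr_linear a (S : seq 'rV[int]_a) : sym_generating S ->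
  exists K : nat, forall g : 'rV[int]_a, exists2 w, word_repr S g w &
    (size w <= K * \sum_i `|g 0%R i|)%N.
Proof.
move=> [Sopp Sgen].
have /choice[v vP] (i : 'I_a) := Sgen (delta_mx 0 i).
exists (\sum_i size (v i))%N => g; set K := (\sum_i _)%N.
have mulnw (h : 'rV[int]_a) w : word_repr S h w -> forall k : nat,
    exists2 u, word_repr S (h *+ k) u & (size u <= size w * k)%N.
  move=> hw; elim=> [|k [u hu uk]].
    by exists nil => //; split => //; rewrite big_nil.
  exists (w ++ u); first by rewrite mulrS; exact: word_repr_cat.
  by rewrite size_cat mulnS leq_add2l.
(* Relating vectors to length budgets lets [big_ind2] run over both sums in parallel. *)
pose rel h s := exists2 w, word_repr S h w & (size w <= K * s)%N.
suff : rel (\sum_i g 0 i *: delta_mx 0 i) (\sum_i `|g 0%R i|)%N.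
  by rewrite -row_sum_delta.
apply: (big_ind2 rel) => [|h1 s1 h2 s2 [w1 ? w1s] [w2 ? w2s]|i _].
- by exists nil => //; split => //; rewrite big_nil.
- exists (w1 ++ w2); first exact: word_repr_cat.
  by rewrite size_cat mulnDr leq_add.
have viK : (size (v i) <= K)%N by rewrite /K (bigD1 i)//= leq_addr.
have [sz|sz] := leP 0 (g 0 i).
  have [u hu us] := mulnw _ _ (vP i) `|g 0%R i|%N.
  exists u; last by rewrite (leq_trans us)// leq_mul.
  by rewrite -{1}(gez0_abs sz) -[Posz _]natz scaler_nat.
have [u hu us] := mulnw _ _ (word_repr_opp Sopp (vP i)) `|g 0%R i|%N.
exists u; last by rewrite (leq_trans us)// size_map leq_mul.
rewrite -{1}[g 0 i]opprK -(ltz0_abs sz) scaleNr -scalerN.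
by rewrite -[Posz _]natz scaler_nat.
Qed.

(** * Cantor space *)

(* The phantom parameter R is the field in which the metric takes its values. *)
Definition bitseqs (R : realType) : Type := nat -> bool.

Section BitseqsMetric.
Variable R : realType.
Local Notation T := (bitseqs R).

HB.instance Definition _ := gen_eqMixin T.
HB.instance Definition _ := gen_choiceMixin T.
HB.instance Definition _ := isPointed.Build T (fun=> false).

Definition cyl (N : nat) (x : T) : set T :=
  [set y | forall j, (j < N)%N -> x j = y j].

(** Open balls of the ultrametric whose value is [1 / (j + 1)] when [j] is the first difference.
    They are empty for [e <= 0], since the triangle inequality must hold for radii of any sign. *)
Definition bitseqs_ball (x : T) (e : R) : set T :=
  [set y | 0 < e /\ forall j : nat, e <= j.+1%:R^-1 -> x j = y j].

Let ball_center (x : T) (e : R) : 0 < e -> bitseqs_ball x e x.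
Proof. by []. Qed.

Let ball_sym (x y : T) (e : R) : bitseqs_ball x e y -> bitseqs_ball y e x.
Proof. by move=> [e0 xy]; split=> // j /xy. Qed.

Let ball_triangle (x y z : T) (e1 e2 : R) :
  bitseqs_ball x e1 y -> bitseqs_ball y e2 z -> bitseqs_ball x (e1 + e2) z.
Proof.
move=> [e10 xy] [e20 yz]; split=> [|j ej]; first exact: addr_gt0.
by rewrite xy ?yz//; apply: le_trans ej; rewrite ?lerDl ?lerDr ltW.
Qed.

HB.instance Definition _ := hasNbhs.Build T (nbhs_ (entourage_ bitseqs_ball)).
HB.instance Definition _ := Nbhs_isPseudoMetric.Build R T
  (erefl _) ball_center ball_sym ball_triangle (erefl _).

Lemma ball_cyl (x : T) (N : nat) : ball x N.+1%:R^-1 = cyl N.+1 x.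
Proof.
apply/seteqP; split => y.
  by move=> [_ xy] j jN; apply: xy; rewrite lef_pV2 ?posrE// ler_nat.
move=> xy; split=> [|j]; first by rewrite invr_gt0.
by rewrite lef_pV2 ?posrE// ler_nat => /xy.
Qed.

Lemma nbhs_cyl (x : T) (A : set T) : nbhs x A <-> exists N, cyl N x `<=` A.
Proof.
split=> [/nbhs_ballP[e e0 eA]|[N NA]].
  exists (Num.truncn e^-1).+1; rewrite -ball_cyl; apply: subset_trans eA.
  apply: le_ball; rewrite -[leRHS]invrK lef_pV2 ?posrE ?invr_gt0//.
  by rewrite ltW// truncnS_gt.
apply/nbhs_ballP; exists N.+1%:R^-1; first by rewrite /= invr_gt0.
by rewrite ball_cyl => y xy; apply: NA => j jN; apply/xy/ltnW.
Qed.

Lemma bitseqs_hausdorff : hausdorff_space T.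
Proof.
move=> p q /(_ (cyl _ p) (cyl _ q)) pq; apply/funext => j.
have [||z [pz qz]] := pq j.+1 j.+1; [by apply/nbhs_cyl; exists j.+1..|].
by rewrite pz// qz.
Qed.

Lemma bitseqs_complete (F : set_system T) : ProperFilter F -> cauchy F -> cvg F.
Proof.
move=> FF /(@cauchyP R) Fc.
have [N|c cP] := @choice _ _ (fun N x => F (cyl N.+1 x)).
  have [|x] := Fc N.+1%:R^-1; first by rewrite invr_gt0.
  by rewrite ball_cyl => Fx; exists x.
(* The limit is the diagonal: the cylinders around [c N] and [c j] both lie in [F], hence meet, so
   [c N] and [c j] agree at [j] when [j <= N]. *)
apply/cvg_ex; exists (fun j => c j j); apply/fcvg_ballP => e e0.
have [N] : exists N : nat, N.+1%:R^-1 <= e.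
  exists (Num.truncn e^-1); rewrite -[leRHS]invrK lef_pV2 ?posrE ?invr_gt0//.
  by rewrite ltW// truncnS_gt.
move=> /le_ball sub.
apply: filterS (cP N) => y cy; apply: sub; rewrite ball_cyl => j jN.
have [z [cz cz']] := @filter_ex _ _ FF _ (filterI (cP N) (cP j)).
by rewrite cz'// -cz// cy.
Qed.

HB.instance Definition _ := Uniform_isComplete.Build T bitseqs_complete.

Definition bits := g_sigma_algebraType [set U : set T | open U].

HB.instance Definition _ := Measurable.on bits.

Lemma open_cyl N x : open (cyl N x).
Proof.
rewrite openE => y xy; apply/nbhs_cyl; exists N => z yz j jN.
by rewrite xy ?yz.
Qed.

Lemma measurable_cyl N x : measurable (cyl N x : set bits).
Proof. by apply: sub_sigma_algebra; exact: open_cyl. Qed.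

(** Finite words index the cylinders by a countable type, so unions of cylinders are countable
    unions. *)
Definition word_cyl (s : seq bool) : set T := cyl (size s) (nth false s).

Lemma cylE N x : cyl N x = word_cyl (mkseq x N).
Proof.
rewrite /word_cyl size_mkseq; apply/seteqP; split => y xy j jN;
  by have := xy j jN; rewrite nth_mkseq.
Qed.

Lemma open_bigcup_cyl (U : set T) : open U ->
  U = \bigcup_(s in [set s | word_cyl s `<=` U]) word_cyl s.
Proof.
rewrite openE => Uo; apply/seteqP; split => [x /Uo/nbhs_cyl[N NU]|x [s sU /sU//]].
by exists (mkseq x N); rewrite /= -cylE.
Qed.

Lemma measurable_prefix N (A : set bits) :
  (forall x y, (forall j, (j < N)%N -> x j = y j) -> A x -> A y) -> measurable A.
Proof.
move=> AN; rewrite (_ : A = \bigcup_(s in [set s | size s = N /\ A (nth false s)])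
    (word_cyl s : set bits)).
  rewrite bigcup_mkcond; apply: countable_bigcupT_measurable => [|s].
    exact: countableP.
  by case: ifP => _; [exact: measurable_cyl|exact: measurable0].
apply/seteqP; split => [x Ax|x [s [sN As]] sx].
  exists (mkseq x N); last by rewrite -cylE.
  split; first by rewrite size_mkseq.
  by apply: AN Ax => j jN; rewrite nth_mkseq.
by apply: AN As => j jN; rewrite sx ?sN.
Qed.

Lemma bits_standard : standard_borel R bits.
Proof.
exists T, id; split.
- exact: bitseqs_hausdorff.
- exists (range (fun s : seq bool => nth false s : T)).
    exact: card_le_trans (card_image_le _ _) (countableP _).
  move=> U [x Ux] Uo; have /nbhs_cyl[N NU] := open_nbhs_nbhs (conj Uo Ux).
  exists (nth false (mkseq x N)); split; last by exists (mkseq x N).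
  by apply: NU => j jN; rewrite nth_mkseq.
- exact: (Bijective (fun=> erefl) (fun=> erefl)).
- by move=> A; rewrite image_id.
Qed.

Lemma measurable_fun_bits d (S : measurableType d) (f : S -> bits) :
  (forall N x, measurable (f @^-1` (cyl N x))) -> measurable_fun setT f.
Proof.
move=> fcyl.
apply: (@measurability _ _ S bits setT f [set U : set T | open U]) => //.
move=> _ [U Uo <-]; rewrite setTI (open_bigcup_cyl Uo) preimage_bigcup.
rewrite bigcup_mkcond; apply: countable_bigcupT_measurable => [|s].
  exact: countableP.
by case: ifP => _; [exact: fcyl|exact: measurable0].
Qed.

(** Two cylinders are nested or disjoint, so with the empty set they form a generating family closed
    under intersection. The cylinder of length 0 is the whole space, of finite measure. *)
Lemma bits_measure_unique (m1 m2 : {measure set bits -> \bar R}) :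
  (m1 setT < +oo)%E ->
  (forall N x, m1 (cyl N x) = m2 (cyl N x)) ->
  forall A, measurable A -> m1 A = m2 A.
Proof.
move=> m1oo m12.
pose G := [set A : set bits | A = set0 \/ exists N x, A = cyl N x].
have cyl0 : cyl 0 (fun=> false) = setT by apply/seteqP; split.
apply: (measure_unique G (fun=> setT)) => //.
- apply/seteqP; split; last first.
    apply: smallest_sub; first exact: sigma_algebra_measurable.
    by move=> _ [->|[N [x ->]]]; [exact: measurable0|exact: measurable_cyl].
  apply: smallest_sub; first exact: smallest_sigma_algebra.
  move=> U /open_bigcup_cyl ->; rewrite bigcup_mkcond.
  apply: (@countable_bigcupT_measurable _ (g_sigma_algebraType G)) => [|s].
    exact: countableP.
  case: ifP => _; last exact: measurable0.
  by apply: sub_sigma_algebra; right; exists (size s), (nth false s).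
- move=> _ _ [->|[N [x ->]]] [->|[M [y ->]]]; rewrite ?set0I ?setI0; try by left.
  wlog NM : N M x y / (N <= M)%N.
    by move=> h; have [/h//|/ltnW /h] := leqP N M; rewrite setIC.
  have [xy|xy] := pselect (forall j, (j < N)%N -> x j = y j).
    right; exists M, y; apply/seteqP; split => [z []//|z yz]; split => // j jN.
    by rewrite xy// yz// (leq_trans jN).
  left; rewrite -subset0 => z [xz yz]; apply: xy => j jN.
  by rewrite xz// yz// (leq_trans jN).
- by move=> _; right; exists 0%N, (fun=> false).
- by rewrite bigcup_const.
- by move=> _ [->|[N [x ->]]]; rewrite ?measure0.
Qed.

End BitseqsMetric.

(** * The fair coin measure *)

Section FairCoin.
Variable R : realType.

(** The fair coin measure is the image of Lebesgue measure on [[0, 1[] under binary expansion;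
    points outside the interval get the zero sequence. *)
Definition binary_digits (t : measurableTypeR R) : bits R :=
  fun j => (0 <= t < 1) && ((Num.floor (2 ^+ j.+1 * t) %% 2)%Z == 1).

(** Unlike in [low_bits], the first digit is the most significant: this is the numerator of the left
    end of a dyadic interval. *)
Fixpoint prefix_value (N : nat) (x : nat -> bool) : int :=
  if N is N'.+1 then prefix_value N' x * 2 + (x N')%:Z else 0.

Lemma prefix_value_bounds N x : 0 <= prefix_value N x < 2 ^+ N.
Proof. by elim: N => //= N; rewrite exprS; case: (x N); lia. Qed.

Lemma floor_binary_digits (t : R) N : 0 <= t < 1 ->
  Num.floor (2 ^+ N.+1 * t) =
  Num.floor (2 ^+ N * t) * 2 + (binary_digits t N)%:Z.
Proof.
move=> t01; rewrite /binary_digits t01 exprS -mulrA; set s := 2 ^+ N * t.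
set f := Num.floor (2 * s); have /andP[f1 f2] := floor_itv (2 * s).
have /andP[g1 g2] := floor_itv s; rewrite -/f in f1 f2.
set g := Num.floor s in g1 g2 *.
have gf : 2 * g <= f by rewrite /f floor_ge_int intrM ler_pM2l.
have fg : f < 2 * g + 2.
  rewrite -(ltr_int R) (le_lt_trans f1)// intrD intrM.
  by move: g2; rewrite intrD; lra.
have := divz_eq f 2; have : 0 <= (f %% 2)%Z < 2 by rewrite modz_ge0//= ltz_pmod.
by case: eqP; lia.
Qed.

Lemma cyl_binary_digits (t : R) N x : 0 <= t < 1 ->
  @cyl R N x (binary_digits t) <-> Num.floor (2 ^+ N * t) = prefix_value N x.
Proof.
move=> t01; elim: N => [|N IH] /=.
  by rewrite expr0 mul1r (floor_def (m := 0))//; split.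
rewrite floor_binary_digits//; split => [xt|eqs].
  rewrite xt//; congr (_ * 2 + _); apply/IH => j jN; exact/xt/ltnW.
have [/IH xt xN] : Num.floor (2 ^+ N * t) = prefix_value N x /\
    x N = binary_digits t N.
  by move: eqs; case: (x N); case: (binary_digits t N); lia.
by move=> j; rewrite ltnS leq_eqVlt => /predU1P[->//|/xt].
Qed.

Lemma binary_digits_itv N x :
  binary_digits @^-1` (cyl N x) `&` `[0%R, 1%R[ =
  [set` `[(prefix_value N x)%:~R / 2 ^+ N, (prefix_value N x + 1)%:~R / 2 ^+ N[ ].
Proof.
have p0 : 0 < 2 ^+ N :> R by rewrite exprn_gt0.
have /andP[v0 v1] := prefix_value_bounds N x.
have floorE (t : R) :
    (t \in `[(prefix_value N x)%:~R / 2 ^+ N, (prefix_value N x + 1)%:~R / 2 ^+ N[) =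
    (Num.floor (2 ^+ N * t) == prefix_value N x).
  by rewrite floor_eq in_itv/= ler_pdivrMr// ltr_pdivlMr// mulrC.
apply/seteqP; split => t /=.
  by move=> [xt]; rewrite in_itv/= floorE => t01; apply/eqP/cyl_binary_digits.
move=> tI; have t01 : 0 <= t < 1.
  move: tI; rewrite in_itv/= => /andP[t1 t2]; apply/andP; split.
    by apply: le_trans t1; rewrite divr_ge0 ?ler0z// ltW.
  apply: (lt_le_trans t2); rewrite ler_pdivrMr// mul1r.
  have : (prefix_value N x + 1)%:~R <= (2 ^+ N)%:~R :> R by rewrite ler_int; lia.
  by rewrite rmorphXn.
rewrite in_itv/=; split => //; apply/cyl_binary_digits => //.
by apply/eqP; rewrite -floorE.
Qed.

Lemma measurable_binary_digits :
  measurable_fun [set: measurableTypeR R] binary_digits.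
Proof.
apply: measurable_fun_bits => N x.
(* Inside [[0, 1[] the preimage is a dyadic interval. Outside, the map is constant, so the preimage
   contains everything or nothing. *)
set P := _ @^-1` _; rewrite -(setUIDK P `[0%R, 1%R[) binary_digits_itv.
apply: measurableU => //.
have [x0|x0] := pselect (cyl N x (fun=> false)).
  rewrite (_ : _ `\` _ = ~` `[0%R, 1%R[).
    by apply: measurableC; exact: measurable_itv.
  apply/seteqP; split => [t []//|t t01]; split => // j jN.
  by move: t01; rewrite x0//= in_itv/= /binary_digits => /negP/negbTE ->.
rewrite (_ : _ `\` _ = set0) -?subset0// => t [Pt t01]; apply: x0 => j jN.
by move: t01; rewrite Pt//= in_itv/= /binary_digits => /negP/negbTE ->.
Qed.

Definition unit_lebesgue : set (measurableTypeR R) -> \bar R :=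
  mrestr lebesgue_measure (measurable_itv `[0%R, 1%R[).

HB.instance Definition _ := Measure.on unit_lebesgue.

Let unit_lebesgueT : unit_lebesgue setT = 1%E.
Proof.
by rewrite /unit_lebesgue /mrestr setTI lebesgue_measure_itv/= lte01 oppr0 adde0.
Qed.

HB.instance Definition _ :=
  Measure_isProbability.Build _ _ _ unit_lebesgue unit_lebesgueT.

HB.instance Definition _ :=
  isMeasurableFun.Build _ _ (measurableTypeR R) (bits R) binary_digits
    measurable_binary_digits.

Definition fair_coin : probability (bits R) R :=
  distribution unit_lebesgue binary_digits.

Lemma fair_coin_cyl N x : fair_coin (cyl N x) = (2 ^- N)%:E.
Proof.
rewrite /fair_coin /= /distribution /pushforward /= /unit_lebesgue /mrestr.
rewrite binary_digits_itv lebesgue_measure_itv/= lte_fin.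
rewrite ltr_pM2r ?invr_gt0 ?exprn_gt0// ltr_int ltrDl ltr01.
by rewrite -EFinB -mulrBl intrD addrAC subrr add0r mul1r.
Qed.

End FairCoin.

(** * Odometers and the fair coin measure *)

Definition bits_odometer (R : realType) a (g : 'rV[int]_a) (x : bits R) :
  bits R := odometer g x.

Section OdometerMeasure.
Variables (R : realType) (a : nat) (a_gt0 : (0 < a)%N).
Local Notation mu := (fair_coin R).
Implicit Types (g : 'rV[int]_a) (x : bits R).
Local Notation act := (@bits_odometer R a).

Lemma odometer_action : is_action act.
Proof. by split=> [x|g h x]; [exact: odometer0|exact: odometerD]. Qed.

(** Translation by [g] and its inverse both respect agreement on the first [N] digits. Cylinder
    lengths, hence measures, are thus preserved. *)
Lemma preimage_odometer_cyl g N x :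
  act g @^-1` (cyl N x) = cyl N (act (- g) x).
Proof.
rewrite /bits_odometer; apply/seteqP; split => y xy j jN.
  rewrite (@eq_odometer a (- g) x (odometer g y) N)//.
  by rewrite -odometerD// addNr odometer0.
rewrite (@eq_odometer a g y (odometer (- g) x) N)//.
  by rewrite -odometerD// subrr odometer0.
by move=> k /xy.
Qed.

Lemma measurable_odometer g : measurable_fun [set: bits R] (act g).
Proof.
apply: measurable_fun_bits => N x; rewrite preimage_odometer_cyl.
exact: measurable_cyl.
Qed.

HB.instance Definition _ g :=
  isMeasurableFun.Build _ _ (bits R) (bits R) (@bits_odometer R a g)
    (measurable_odometer g).

Lemma pmp_odometer : pmp mu act.
Proof.
move=> g; split; first exact: measurable_odometer.
apply: (bits_measure_unique (m1 := distribution mu (act g))).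
  apply: le_lt_trans (ltry 1).
  exact: (probability_le1 (distribution mu (act g)) measurableT).
move=> N x; rewrite -[LHS]/(mu (act g @^-1` cyl N x)) -[RHS]/(mu (cyl N x)).
by rewrite preimage_odometer_cyl !fair_coin_cyl.
Qed.

Lemma ess_free_odometer : ess_free mu act.
Proof. by apply: aeW => x g; exact: odometer_free. Qed.

Definition strand_fiber (i r : nat) (v : int) : set (bits R) :=
  [set x | low_bits (strand a i x) r = v].

Lemma measurable_strand_fiber i r v : measurable (strand_fiber i r v).
Proof.
apply: (@measurable_prefix _ (r * a + i)) => x y xy <-; apply: eq_low_bits => j jr.
by rewrite /strand -xy// ltn_add2r ltn_mul2r a_gt0.
Qed.

(* Translations along the i-th generator permute the fibres transitively, so
   these 2 ^ r disjoint sets have equal measure. *)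
Lemma strand_fiber_measure (i : 'I_a) r (v : nat) :
  (mu (strand_fiber i r v%:Z) <= (2 ^- r)%:E)%E.
Proof.
have [vr|vr] := ltnP v (2 ^ r)%N; last first.
  rewrite (_ : strand_fiber _ _ _ = set0) ?measure0//.
  rewrite -subset0 => x xv; have := low_bits_bounds (strand a i x) r.
  by rewrite xv => /andP[_]; rewrite -natrX; lia.
have shiftE (w : nat) : (w < 2 ^ r)%N ->
    mu (strand_fiber i r w%:Z) = mu (strand_fiber i r 0).
  have qE : 2 ^+ r = (2 ^ r)%N%:Z by rewrite -natz natrX.
  move=> wr; pose g : 'rV[int]_a := w%:Z *: delta_mx 0 i.
  have [_ /(_ _ (measurable_strand_fiber i r w)) <-] := pmp_odometer g.
  have xE x : low_bits (strand a i (bits_odometer g x)) r =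
      ((low_bits (strand a i x) r + w%:Z) %% 2 ^+ r)%Z.
    by rewrite strand_odometer// low_bits_adic_add entryE !mxE !eqxx mulr1.
  congr (fair_coin _ _); apply/seteqP; split => x; rewrite /strand_fiber /= xE.
    have := low_bits_bounds (strand a i x) r; set y := low_bits _ _ => yb.
    have [yw|yw] := ltP (y + w%:Z) (2 ^+ r); first by rewrite modz_small; lia.
    by rewrite -[y + _](subrK (2 ^+ r)) modzDr modz_small; lia.
  by move=> ->; rewrite add0r modz_small//=; lia.
rewrite shiftE//; pose F w : set (bits R) := strand_fiber i r w%:Z.
have : (mu (\big[setU/set0]_(w < (2 ^ r)%N) F w) <= 1)%E.
  apply: probability_le1; apply: bigsetU_measurable => w _.
  exact: measurable_strand_fiber.
rewrite measure_bigsetU; last 2 first.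
- by move=> w; exact: measurable_strand_fiber.
- by move=> u w _ _ [x [xu xw]]; apply/eqP; rewrite -eqz_nat -xu -xw.
have /fineK : mu (strand_fiber i r 0) \is a fin_num.
  by apply: fin_num_measure; exact: measurable_strand_fiber.
set f := fine _ => fE; rewrite (eq_bigr (fun=> f%:E)) => [|w _]; last first.
  by rewrite -[RHS]/(f%:E) fE; exact: shiftE.
rewrite sumEFin sumr_const card_ord -fE !lee_fin -[f *+ _]mulr_natr natrX => le1.
by rewrite -[leRHS]mul1r ler_pdivlMr// exprn_gt0.
Qed.

(** The threshold [N] is free because the measure bound takes multiples of the rank of [g], and the
    distance bound multiples of the other rank. *)
Definition tail_moved g N : set (bits R) :=
  [set x | exists2 j, (N <= j)%N & bits_odometer g x j <> x j].

Lemma measurable_tail_moved g N : measurable (tail_moved g N).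
Proof.
rewrite (_ : tail_moved g N =
    \bigcup_(j in [set j | (N <= j)%N]) [set x | bits_odometer g x j <> x j]).
  apply: bigcup_measurable => j _; apply: (@measurable_prefix _ j.+1) => x y xy.
  by rewrite /= /bits_odometer -(xy j)// (@eq_odometer _ g x y j.+1)//.
by apply/seteqP; split => x [j Nj xj]; exists j.
Qed.

Lemma measure_bigsetU_le (I : Type) (s : seq I) (F : I -> set (bits R)) :
  (forall i, measurable (F i)) ->
  (mu (\big[setU/set0]_(i <- s) F i) <= \sum_(i <- s) mu (F i))%E.
Proof.
move=> mF; elim: s => [|i s IH]; first by rewrite !big_nil measure0.
rewrite !big_cons; apply: le_trans (leeD2l _ IH); apply: measureU2 => //.
exact: bigsetU_measurable.
Qed.

(* A carry out of the lowest r digits of a strand needs these digits to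
   represent a number within |g_i| of one of the two ends of [0, 2 ^ r[. *)
Lemma tail_moved_measure g r :
  (mu (tail_moved g (r * a)) <= (((\sum_i `|g 0%R i|) * 2)%N%:R * 2 ^- r)%:E)%E.
Proof.
(* These are the [u]-th residues from either end. If [u >= 2 ^ r] the subtraction truncates to 0,
   which is harmless in a covering. *)
pose E i (u : nat) : set (bits R) :=
  strand_fiber i r u%:Z `|` strand_fiber i r (2 ^ r - u.+1)%N%:Z.
have mE i u : measurable (E i u).
  by apply: measurableU; exact: measurable_strand_fiber.
pose B : set (bits R) :=
  \big[setU/set0]_(i < a) \big[setU/set0]_(u < `|g 0%R i|%N) E i u.
have mB : measurable B.
  by apply: bigsetU_measurable => i _; exact: bigsetU_measurable.
have qE : 2 ^+ r = (2 ^ r)%N%:Z by rewrite -natz natrX.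
have sub : tail_moved g (r * a) `<=` B.
  move=> x [j rj xj]; apply: contrapT => nB; apply: xj.
  apply: (odometer_carry_free a_gt0 _ rj) => i.
  have := low_bits_bounds (strand a i x) r; set v := low_bits _ _ => vb.
  apply: contrapT => out; have [u ug vE] : exists2 u, (u < `|g 0%R i|)%N &
      v = u%:Z \/ v = (2 ^ r - u.+1)%N%:Z.
    (* An overflow puts [v] less than [g 0 i] places from the top, a borrow less than [- g 0 i]
       places from the bottom. *)
    have [vg|vg] := leP 0 (v + g 0 i).
      exists (2 ^ r - `|v|.+1)%N; lia.
    exists `|v|%N; lia.
  apply: nB; rewrite /B (bigD1 i)//=; left; rewrite (bigD1 (Ordinal ug))//=; left.
  exact: vE.
apply: (le_trans (le_measure mu _ _ sub)); rewrite ?inE//.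
  exact: measurable_tail_moved.
apply: (le_trans (measure_bigsetU_le _ _)) => [i|].
  exact: bigsetU_measurable.
rewrite natrM natr_sum mulr_suml mulr_suml -sumEFin; apply: lee_sum => i _.
apply: (le_trans (measure_bigsetU_le _ _)) => [//|].
rewrite (_ : _%:E = \sum_(u < `|g 0%R i|%N) (2 * 2 ^- r)%:E)%E; last first.
  rewrite sumEFin sumr_const card_ord; congr (_%:E).
  by rewrite -mulrA; exact: mulr_natl.
apply: lee_sum => u _; apply: le_trans (measureU2 _ _ _) _.
- exact: measurable_strand_fiber.
- exact: measurable_strand_fiber.
by rewrite mulr_natl mulr2n EFinD leeD// strand_fiber_measure.
Qed.

End OdometerMeasure.

(** * Integrability *)

(* [ge0_le_integral] asks for the measurability of f, which is unknown for the
   orbit distance. *)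
Lemma ge0_le_integralT d (T : measurableType d) (R : realType)
    (mu : {measure set T -> \bar R}) (f h : T -> \bar R) :
  (forall x, 0 <= f x)%E -> (forall x, f x <= h x)%E ->
  (\int[mu]_x f x <= \int[mu]_x h x)%E.
Proof.
move=> f0 fh; have h0 x := le_trans (f0 x) (fh x).
(* The integral of a nonnegative function is a supremum over the simple functions below it, and a
   larger function has more of them. *)
rewrite !ge0_integralTE//; apply: le_ereal_sup => _ [s sf <-].
by exists s => // x; exact: le_trans (fh x).
Qed.

(** The function is dominated by the sum of the [c k] times the indicators of [A k]: the least [j]
    with [x] outside [A j.+1] has [x] in [A j], even if the sets do not decrease. Integrating
    termwise leaves a geometric series. *)
Lemma integral_layers_lty d (T : measurableType d) (R : realType)
    (mu : {measure set T -> \bar R}) (f : T -> \bar R) (A : nat -> set T)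
    (c : nat -> R) (M q : R) :
  A 0%N = setT -> (forall k, measurable (A k)) ->
  (forall x, 0 <= f x)%E -> (forall k, 1 <= c k) ->
  (forall k x, ~ A k.+1 x -> f x <= (c k)%:E)%E ->
  0 <= M -> 0 < q -> q < 1 ->
  (forall k, (c k)%:E * mu (A k) <= (M * q ^+ k)%:E)%E ->
  (\int[mu]_x f x < +oo)%E.
Proof.
move=> A0 mA f0 c1 fc M0 q0 q1 cA.
have c0 k : 0 <= c k by exact: le_trans (c1 k).
pose F k (x : T) : \bar R := (c k * \1_(A k) x)%:E.
have F0 k x : (0 <= F k x)%E by rewrite lee_fin mulr_ge0.
have mF k : measurable_fun setT (F k).
  by apply/measurable_EFinP/measurable_funM => //; exact: measurable_indic.
(* At a point of every A k the series diverges, its terms being at least 1. *)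
have fF x : (f x <= \sum_(0 <= k <oo) F k x)%E.
  have [[k Ak]|allA] := pselect (exists k, ~ A k.+1 x); last first.
    have {}allA k : A k x.
      case: k => [|k]; first by rewrite A0.
      by apply: contrapT => nA; apply: allA; exists k.
    rewrite [leRHS](_ : _ = +oo)%E ?leey//; apply: eq_infty => r.
    apply: le_trans (nneseries_lim_ge (Num.truncn r).+1 _) => //.
    apply: (@le_trans _ _ (\sum_(0 <= k < (Num.truncn r).+1) 1%:E)%E).
      rewrite sumEFin sumr_const_nat subn0 lee_fin.
      by rewrite ltW// truncnS_gt.
    apply: lee_sum => k _; rewrite lee_fin indicE mem_set// mulr1.
    exact: c1.
  have [j /asboolP Aj jmin] :=
    ex_minnP (ex_intro (fun k => `[< ~ A k.+1 x >]) k (asboolT Ak)).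
  have Aj' : A j x.
    case: j {Aj} jmin => [|j] jmin; first by rewrite A0.
    by apply: contrapT => nA; have := jmin j (asboolT nA); rewrite ltnn.
  apply: le_trans (nneseries_lim_ge j.+1 _) => //.
  rewrite big_nat_recr//= -[leLHS]add0e leeD//; first exact: sume_ge0.
  by rewrite /F indicE mem_set// mulr1; exact: fc.
apply: le_lt_trans (ge0_le_integralT mu f0 fF) _.
rewrite integral_nneseries//.
apply: (@le_lt_trans _ _ (M * (1 - q)^-1)%:E); last exact: ltry.
apply: lime_le.
  by apply: is_cvg_nneseries => k _ _; exact: integral_ge0.
apply: nearW => n; apply: (@le_trans _ _ (\sum_(0 <= k < n) (M * q ^+ k)%:E)%E).
  apply: lee_sum => k _.
  rewrite (integralZl_indic measurableT (fun=> A k)) => //; last first.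
    by move=> ck; have := c0 k; rewrite leNgt ck.
  by rewrite integral_indic// setIT.
rewrite sumEFin lee_fin; apply: (geometric_le_lim n M0 q0).
by rewrite ger0_norm ?ltW.
Qed.

(** * Orbit distances between odometers of two ranks *)

Lemma orbit_dist_ge0 (R : realType) (X : Type) (G : zmodType) (S : seq G)
  (act : G -> X -> X) x y : (0 <= orbit_dist R S act x y)%E.
Proof.
apply: le_ereal_inf_tmp => _ [g _ <-]; apply: le_ereal_inf_tmp => _ [w _ <-].
by rewrite lee_fin.
Qed.

Lemma orbit_dist_le (R : realType) (X : Type) (G : zmodType) (S : seq G)
    (act : G -> X -> X) x g w :
  word_repr S g w -> (orbit_dist R S act x (act g x) <= (size w)%:R%:E)%E.
Proof.
move=> gw; apply: (@le_trans _ _ (word_length R S g)).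
  by apply: ereal_inf_lbound; exists g.
by apply: ereal_inf_lbound; exists w.
Qed.

Section Coupling.
Variables (R : realType) (a b : nat) (a_gt0 : (0 < a)%N) (b_gt0 : (0 < b)%N).
Local Notation mu := (fair_coin R).
Implicit Types x : bits R.

Lemma not_tail_moved_odometer (g : 'rV[int]_a) x r :
  ~ tail_moved g (r * b) x ->
  exists2 h : 'rV[int]_b, bits_odometer g x = bits_odometer h x &
    forall i, `|h 0 i| < 2 ^+ r.
Proof.
move=> nA; apply: (eq_tail_odometer b_gt0) => j rj.
by apply: contrapT => xj; apply: nA; exists j => // /esym.
Qed.

Lemma orbit_dist_odometer_le (S : seq 'rV[int]_b) : sym_generating S ->
  exists K : nat, forall (g : 'rV[int]_a) x r, ~ tail_moved g (r * b) x ->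
    (orbit_dist R S (@bits_odometer R b) x (bits_odometer g x)
      <= (K * 2 ^ r)%N%:R%:E)%E.
Proof.
(* The factor [b] counts the entries of [h], each below [2 ^ r] in absolute value. *)
move=> /word_repr_linear[K KP]; exists (K * b)%N => g x r.
move=> /not_tail_moved_odometer[h -> hr]; have [w hw wK] := KP h.
apply: le_trans (orbit_dist_le _ _ _ hw) _; rewrite lee_fin ler_nat.
apply: leq_trans wK _; rewrite -mulnA leq_mul2l; apply/orP; right.
rewrite -[X in (_ <= X * _)%N]card_ord -sum_nat_const; apply: leq_sum => i _.
by have := hr i; rewrite -natrX; lia.
Qed.

(** Exceptions exist: adding 1 to a strand of ones changes all its digits. For fixed [g] they lie in
    every [tail_moved g (r * a)], of measure O(2^(-r)); and Z^a is countable. *)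
Lemma ae_tail_fixed : {ae mu, forall x, forall g : 'rV[int]_a,
  exists N, ~ tail_moved g N x}.
Proof.
have Ng (g : 'rV[int]_a) :
    mu.-negligible (\bigcap_N (tail_moved g N : set (bits R))).
  have mI : measurable (\bigcap_N (tail_moved g N : set (bits R))).
    by apply: bigcap_measurable => // N _; exact: measurable_tail_moved.
  apply/negligibleP => //; apply/eqP; rewrite eq_le measure_ge0 andbT.
  apply/lee_addgt0Pr => e e0; rewrite add0e.
  pose C : R := ((\sum_i `|g 0%R i|) * 2)%N%:R.
  (* This gives [C / e <= r + 1 <= 2 ^ r]. *)
  pose r := Num.truncn (C / e).
  apply: (@le_trans _ _ (C * 2 ^- r)%:E).
    apply: le_trans (tail_moved_measure R a_gt0 g r).
    apply: le_measure; rewrite ?inE//; first exact: measurable_tail_moved.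
    exact: bigcap_inf.
  rewrite lee_fin ler_pdivrMr ?exprn_gt0// mulrC -ler_pdivrMr//.
  apply: (@le_trans _ _ r.+1%:R); first by rewrite ltW// truncnS_gt.
  by rewrite -natrX ler_nat ltn_expl.
(* Enumerating the vectors by [unpickle] merges the null sets; codes of no vector impose nothing. *)
pose P n x :=
  if unpickle n is Some g then exists N, ~ @tail_moved R a g N x else True.
have : \forall x \ae mu, forall n, P n x.
  apply: ae_foralln => n; rewrite /P; case: unpickle => [g|]; last exact: aeW.
  apply: negligibleS (Ng g) => x /= nx N _; apply: contrapT => xN.
  by apply: nx; exists N.
by apply: filterS => x xP g; have := xP (pickle g); rewrite /P pickleK.
Qed.

Lemma ae_orbit_sub : {ae mu, forall x,
  orbit_of (@bits_odometer R a) x `<=` orbit_of (@bits_odometer R b) x}.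
Proof.
apply: filterS ae_tail_fixed => x xN _ [g _ <-].
have [N gN] := xN g.
(* Since [b > 0], the threshold [N * b] is at least [N]. *)
have [|h gh _] := @not_tail_moved_odometer g x N; last by exists h.
move=> [j Nj xj]; apply: gN; exists j => //.
by rewrite (leq_trans _ Nj)// leq_pmulr.
Qed.

Lemma integral_orbit_dist_lty (S : seq 'rV[int]_b) (p : R) (g : 'rV[int]_a) :
  sym_generating S -> 0 < p -> p * a%:R < b%:R ->
  (\int[mu]_x (orbit_dist R S (@bits_odometer R b) x (bits_odometer g x) `^ p)
    < +oo)%E.
Proof.
move=> /orbit_dist_odometer_le[K KP] p0 pab.
(* The index is shifted: outside [A k.+1] only the lowest [k * a] digits of the [b] strands change,
   so the distance is at most [K * 2 ^ (k * a)]. *)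
pose A k : set (bits R) := if k is k'.+1 then tail_moved g (k' * b * a) else setT.
(* The successor of [K] ensures [1 <= c k] even if [K = 0]. *)
pose c k := (K.+1 * 2 ^ (k * a))%N%:R `^ p.
pose C := ((\sum_i `|g 0%R i|) * 2)%N.
pose L := K.+1%:R `^ p; pose t := 2 `^ (p * a%:R) : R.
have t0 : 0 < t by rewrite powR_gt0.
have L1 : 1 <= L by rewrite -(powRr0 K.+1%:R) ler_powR ?ler1n// ltW.
have cE k : c k = L * t ^+ k.
  rewrite /c natrM powRM// natrX -powR_mulrn// -powRrM; congr (_ * _).
  by rewrite -powR_mulrn ?powR_ge0// -powRrM natrM; congr (_ `^ _); ring.
have D2 : 0 < 2 ^+ b :> R by rewrite exprn_gt0.
(* The factor [2 ^+ b] pays for the index shift in [A], and [C.+1] instead of [C] covers the layer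
   [k = 0], of full measure. *)
apply: (@integral_layers_lty _ _ _ mu _ A c
  (L * (C.+1%:R * 2 ^+ b)) (t / 2 ^+ b)).
- by [].
- by move=> [|k]; [exact: measurableT|exact: (@measurable_tail_moved R a)].
- by move=> x; exact: poweR_ge0.
- move=> k; rewrite -(powRr0 (K.+1 * 2 ^ (k * a))%N%:R).
  by apply: ler_powR; [rewrite ler1n muln_gt0 expn_gt0|exact: ltW].
- move=> k x Ak; rewrite -poweR_EFin.
  apply: gt0_ler_poweR; rewrite ?in_itv/= ?leey ?orbit_dist_ge0 ?andbT ?lee_fin//.
    exact: ltW.
  apply: le_trans (KP g x (k * a)%N _) _; first by rewrite mulnAC.
  by rewrite lee_fin ler_nat leq_mul.
- by rewrite !mulr_ge0// ?ltW// (lt_le_trans _ L1).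
- by rewrite divr_gt0.
- rewrite ltr_pdivrMr// mul1r -powR_mulrn// /t /powR gt_eqF//.
  by rewrite ltr_expR ltr_pM2r ?ln_gt0 ?ltr1n.
move=> [|k].
  apply: (@le_trans _ _ (c 0%N)%:E).
    rewrite -[leRHS]mule1; apply: lee_wpmul2l; first by rewrite lee_fin powR_ge0.
    exact: (probability_le1 mu measurableT).
  rewrite cE !expr0 !mulr1 lee_fin.
  rewrite ler_peMr// ?(le_trans _ L1)// mulr_ege1// ?ler1n//.
  by rewrite exprn_ege1// ler1n.
apply: (@le_trans _ _ ((c k.+1)%:E * (C%:R * 2 ^- (k * b))%:E)%E).
  by rewrite lee_wpmul2l ?lee_fin ?powR_ge0//; exact: tail_moved_measure.
rewrite cE -EFinM lee_fin expr_div_n -!mulrA ler_wpM2l ?(le_trans _ L1)//.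
rewrite mulrCA; apply: ler_pM; rewrite ?mulr_ge0 ?invr_ge0 ?exprn_ge0 ?(ltW t0)//.
  by rewrite ler_nat.
rewrite mulrCA ler_wpM2l ?exprn_ge0 ?(ltW t0)//.
by rewrite exprS invfM mulrA mulfV ?gt_eqF// mul1r -exprM mulnC.
Qed.

End Coupling.

Theorem theorem6 (R : realType) (n m : nat) (n_gt0 : (0 < n)%N) (n_lt_m : (n < m)%N) :
  exists (d : measure_display) (X : measurableType d) (mu : probability X R)
    (actG : 'rV[int]_m -> X -> X) (actL : 'rV[int]_n -> X -> X),
    oe_coupling mu actG actL /\
    forall (SG : seq 'rV[int]_m) (SL : seq 'rV[int]_n) (p : R),
      sym_generating SG -> sym_generating SL ->
      0 < p -> p < n%:R / m%:R ->
      LpLp_integrable mu SG SL actG actL p.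
Proof.
have m_gt0 : (0 < m)%N := leq_trans n_gt0 (ltnW n_lt_m).
exists _, (bits R), (fair_coin R), (@bits_odometer R m), (@bits_odometer R n).
split.
  split; first exact: bits_standard.
  - split; first exact: odometer_action.
      exact: pmp_odometer.
    exact: ess_free_odometer.
  - split; first exact: odometer_action.
      exact: pmp_odometer.
    exact: ess_free_odometer.
  - apply: filterS2 (ae_orbit_sub R m_gt0 n_gt0) (ae_orbit_sub R n_gt0 m_gt0).
    by move=> x mn nm; apply/seteqP; split.
move=> SG SL p gSG gSL p0 pnm.
have pm : p * m%:R < n%:R by rewrite -ltr_pdivlMr ?ltr0n.
split=> g; apply: integral_orbit_dist_lty => //.
(* Measuring translations by Z^n in Z^m needs [p * n < m], which follows from
   [p * n < p * m < n < m]. *)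
apply: lt_trans (_ : p * m%:R < _); first by rewrite ltr_pM2l// ltr_nat.
by rewrite (lt_trans pm)// ltr_nat.
Qed.
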